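(* Let $\Gamma$ be a graph and let $\Delta\leq \Gamma_k\leq \Gamma^{\mathrm{ext}}_k$ be finite, separated, and avoiding squares. Then any $\Delta$-supported family $(g_K)_{K\in V(\Delta)}$ of elements of $A(\Gamma)$ induces an injective homomorphism $A(\Delta)\hookrightarrow A(\Gamma)$, $K\mapsto g_K$.
   Context: All graphs are simplicial (unoriented, no loops, no multi-edges), possibly infinite. An induced square is an induced cycle of length 4. $\Delta\le\Theta$ means that $\Delta$ is (embedded as) an induced subgraph of $\Theta$. The right-angled Artin group $A(\Gamma)$ has generating set $V(\Gamma)$ (standard generators), whose only relations are that adjacent vertices commute. For $\Theta\leq\Gamma$, $A(\Theta)$ is identified with the subgroup of $A(\Gamma)$ generated by $V(\Theta)$; a parabolic subgroup of $A(\Gamma)$ is a conjugate of some $A(\Theta)$. For $g\in A(\Gamma)$, $\mathrm{supp}(g)$ is the smallest parabolic subgroup containing $g$. The extension graph $\Gamma^{\mathrm{ext}}$ has vertex set $\{gvg^{-1}\mid g\in A(\Gamma),v\in V(\Gamma)\}$, two vertices being adjacent iff they are distinct commuting elements; $\Gamma\le\Gamma^{\mathrm{ext}}$. The clique graph $\Theta_k$ of a graph $\Theta$ has one vertex for each non-empty finite clique of $\Theta$, two distinct cliques being adjacent iff they are contained in a common clique; $\Gamma^{\mathrm{ext}}_k$ is the clique graph of $\Gamma^{\mathrm{ext}}$, and $\Gamma_k\le\Gamma^{\mathrm{ext}}_k$ naturally. For a vertex $K$ of $\Gamma^{\mathrm{ext}}_k$, $P_K$ is the (abelian parabolic) subgroup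 of $A(\Gamma)$ generated by the vertices of $K$. For $\Delta\le\Gamma^{\mathrm{ext}}_k$: a $\Delta$-supported family is a family $(g_K)_{K\in V(\Delta)}$ of elements of $A(\Gamma)$ with $\mathrm{supp}(g_K)=P_K$ for each $K$; the assignment $K\mapsto g_K$ always extends to a homomorphism $A(\Delta)\to A(\Gamma)$, called the induced homomorphism. $\Delta$ is separated if its vertices correspond to pairwise disjoint cliques of $\Gamma^{\mathrm{ext}}$. $\Delta$ avoids squares if there is no induced square $S$ of $\Gamma^{\mathrm{ext}}$ such that each of the vertices of $S$ and at least one edge of $S$ belong to (possibly distinct) cliques that correspond to vertices of $\Delta$. *)

(* Defs.v *)
From HB Require Import structures.
From mathcomp Require Import fingroup perm.
From mathcomp Require Import all_boot finmap.
From mathcomp Require Import boolp classical_sets cardinality.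

Set Implicit Arguments.
Unset Strict Implicit.
Unset Printing Implicit Defensive.

Local Open Scope classical_set_scope.
Local Open Scope group_scope.
Local Open Scope quotient_scope.

(* Simplicial graphs, possibly infinite.  By the classical axioms of [boolp],
   every type is a choiceType and every relation is boolean, so neither is a
   restriction. *)
Record sgraph := SGraph {
  vertex :> choiceType;
  adj : rel vertex;
  adj_sym : symmetric adj;
  adj_irrefl : irreflexive adj
}.

Arguments adj {s} : simpl never.

Definition induced_embedding (G H : sgraph) (f : G -> H) : Prop :=
  injective f /\ forall x y, adj (f x) (f y) = adj x y.

Section InducedSubgraph.
Variables (G : sgraph) (D : set G).

Definition induced_adj : rel (set_type D) := fun x y => adj (val x) (val y).

Fact induced_adj_sym : symmetric induced_adj.
Proof. by move=> x y; apply: adj_sym. Qed.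

Fact induced_adj_irrefl : irreflexive induced_adj.
Proof. by move=> x; apply: adj_irrefl. Qed.

Definition induced : sgraph := SGraph induced_adj_sym induced_adj_irrefl.

End InducedSubgraph.

Definition square_adj : rel 'I_4 := fun i j => (j == ordS i) || (i == ordS j).

Fact square_adj_sym : symmetric square_adj.
Proof. by move=> i j; rewrite /square_adj orbC. Qed.

Fact square_adj_irrefl : irreflexive square_adj.
Proof. by case=> [[|[|[|[|i]]]] lt_i]. Qed.

Definition square : sgraph := SGraph square_adj_sym square_adj_irrefl.

Definition induced_square (G : sgraph) (s : square -> G) : Prop :=
  induced_embedding s.

(* A(G) is the group presented by the vertices of G and the commutation
   relations: words in the letters (v, true) = v and (v, false) = v^-1, modulo
   the congruence generated by free cancellation and the relations. *)
Definition word (G : sgraph) := seq (G * bool).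

Inductive raag_cong (G : sgraph) : word G -> word G -> Prop :=
| raag_cong_refl w : raag_cong w w
| raag_cong_sym w1 w2 : raag_cong w1 w2 -> raag_cong w2 w1
| raag_cong_trans w2 w1 w3 :
    raag_cong w1 w2 -> raag_cong w2 w3 -> raag_cong w1 w3
| raag_cong_cat w1 w2 w1' w2' :
    raag_cong w1 w1' -> raag_cong w2 w2' -> raag_cong (w1 ++ w2) (w1' ++ w2')
| raag_cong_cancel v b : raag_cong [:: (v, b); (v, ~~ b)] [::]
| raag_cong_comm u v : adj u v ->
    raag_cong [:: (u, true); (v, true)] [:: (v, true); (u, true)].

Section RAAG.
Variable G : sgraph.

Definition raag_congb : rel (word G) := fun w1 w2 => `[< raag_cong w1 w2 >].

Fact raag_congb_refl : reflexive raag_congb.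
Proof. by move=> w; apply/asboolP/raag_cong_refl. Qed.

Fact raag_congb_sym : symmetric raag_congb.
Proof. by move=> u v; apply/asboolP/asboolP; apply: raag_cong_sym. Qed.

Fact raag_congb_trans : transitive raag_congb.
Proof.
by move=> v u w /asboolP uv /asboolP vw; apply/asboolP/(raag_cong_trans uv).
Qed.

Canonical raag_equiv :=
  EquivRel raag_congb raag_congb_refl raag_congb_sym raag_congb_trans.

Definition raag := {eq_quot raag_equiv}.
HB.instance Definition _ := Choice.on raag.
HB.instance Definition _ := Quotient.on raag.
HB.instance Definition _ := EqQuotient.on raag.

Definition raag_class (w : word G) : raag := \pi_raag w.

Lemma raag_classP w1 w2 :
  reflect (raag_cong w1 w2) (raag_class w1 == raag_class w2).
Proof. by rewrite /raag_class piE; apply: asboolP. Qed.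

Lemma raag_class_eq w1 w2 : raag_cong w1 w2 -> raag_class w1 = raag_class w2.
Proof. by move=> w12; apply/eqP/raag_classP. Qed.

Lemma raag_ind (P : raag -> Prop) :
  (forall w, P (raag_class w)) -> forall x, P x.
Proof. by move=> Pw x; rewrite -[x]reprK; apply: Pw. Qed.

Lemma raag_repr w : raag_cong (repr (raag_class w)) w.
Proof. by apply/raag_classP; rewrite /raag_class reprK. Qed.

Definition word_inv (w : word G) : word G := rev [seq (l.1, ~~ l.2) | l <- w].

Lemma word_inv_cons l w : word_inv (l :: w) = word_inv w ++ [:: (l.1, ~~ l.2)].
Proof. by rewrite /word_inv /= rev_cons cats1. Qed.

Lemma word_invK : involutive word_inv.
Proof.
move=> w; rewrite /word_inv map_rev revK -map_comp -[RHS]map_id.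
by apply: eq_map => -[v b] /=; rewrite negbK.
Qed.

Lemma word_mulV w : raag_cong (w ++ word_inv w) [::].
Proof.
elim: w => [|[v b] w IHw]; first exact: raag_cong_refl.
rewrite word_inv_cons catA.
apply: raag_cong_trans (raag_cong_cancel v b).
apply: (@raag_cong_cat _ [:: (v, b)] _ [:: (v, b)]).
  exact: raag_cong_refl.
by apply: (@raag_cong_cat _ _ _ [::]) => //; apply: raag_cong_refl.
Qed.

Lemma word_mulVw w : raag_cong (word_inv w ++ w) [::].
Proof. by rewrite -{2}[w]word_invK; apply: word_mulV. Qed.

Definition raag_one : raag := raag_class [::].
Definition raag_mul (x y : raag) : raag := raag_class (repr x ++ repr y).
Definition raag_inv (x : raag) : raag := raag_class (word_inv (repr x)).

Lemma raag_mulE w1 w2 :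
  raag_mul (raag_class w1) (raag_class w2) = raag_class (w1 ++ w2).
Proof. by apply: raag_class_eq; apply: raag_cong_cat; apply: raag_repr. Qed.

Fact raag_mulA : associative raag_mul.
Proof.
elim/raag_ind=> u; elim/raag_ind=> v; elim/raag_ind=> w.
by rewrite !raag_mulE catA.
Qed.

Fact raag_mul1x : left_id raag_one raag_mul.
Proof. by elim/raag_ind=> w; rewrite raag_mulE. Qed.

Fact raag_mulx1 : right_id raag_one raag_mul.
Proof. by elim/raag_ind=> w; rewrite raag_mulE cats0. Qed.

Fact raag_mulVx : left_inverse raag_one raag_inv raag_mul.
Proof.
move=> x; rewrite -[x in raag_mul _ x]reprK raag_mulE.
exact/raag_class_eq/word_mulVw.
Qed.

Fact raag_mulxV : right_inverse raag_one raag_inv raag_mul.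
Proof.
move=> x; rewrite -[x in raag_mul x _]reprK raag_mulE.
exact/raag_class_eq/word_mulV.
Qed.

HB.instance Definition _ := isGroup.Build raag
  raag_mulA raag_mul1x raag_mulx1 raag_mulVx raag_mulxV.

Definition raag_gen (v : G) : raag := raag_class [:: (v, true)].

Lemma raag_gen_commute u v : adj u v -> commute (raag_gen u) (raag_gen v).
Proof.
move=> uv; rewrite /commute [LHS]raag_mulE [RHS]raag_mulE.
exact/raag_class_eq/raag_cong_comm.
Qed.

Lemma raag_lift (H : groupType) (f : G -> H) :
    (forall u v, adj u v -> commute (f u) (f v)) ->
  exists h : {multiplicative raag -> H}, forall v, h (raag_gen v) = f v.
Proof.
move=> fC; pose ev (w : word G) : H :=
  \prod_(l <- w) (if l.2 then f l.1 else (f l.1)^-1).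
have evE u v : raag_cong u v -> ev u = ev v.
  elim=> {u v} //.
  - by move=> u v w _ -> _ ->.
  - by move=> u v u' v' _ uu' _ vv'; rewrite /ev !big_cat -!/(ev _) uu' vv'.
  - move=> v b; rewrite /ev !big_cons !big_nil mulg1 /=.
    by case: b; rewrite ?mulgV ?mulVg.
  - by move=> u v /fC fuv; rewrite /ev !big_cons !big_nil !mulg1.
pose h (x : raag) := ev (repr x).
have hM : {morph h : x y / x * y}.
  move=> x y; rewrite /h (evE _ _ (raag_repr _)).
  by rewrite /ev big_cat.
pose hm := isMultiplicative.Build raag H h hM.
exists (HB.pack_for {multiplicative raag -> H} h hm) => v /=.
by rewrite /h (evE _ _ (raag_repr _)) /ev big_seq1.
Qed.

End RAAG.

Arguments raag_gen {G} v.

Definition gen_subgroup (H : groupType) (X : set H) : set H :=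
  smallest (fun S : set H => group_closed [in S]) X.

Definition parabolic (G : sgraph) (P : set (raag G)) : Prop :=
  exists (Theta : set G) (h : raag G),
    P = [set h * x * h^-1 | x in gen_subgroup (raag_gen @` Theta)].

(* The smallest parabolic subgroup containing g (it exists, as parabolic subgroups
   of A(G) are closed under intersection), written as the intersection of all of
   them; see [suppP]. *)
Definition supp (G : sgraph) (g : raag G) : set (raag G) :=
  smallest (@parabolic G) [set g].

Lemma suppP (G : sgraph) (g : raag G) (P : set (raag G)) : parabolic P ->
  supp g = P <-> P g /\ forall Q, parabolic Q -> Q g -> P `<=` Q.
Proof.
move=> parP; split=> [<-|[Pg minP]].
  split=> [|Q parQ Qg]; first exact: sub_gen_smallest.
  by apply: smallest_sub => // _ ->.
apply/seteqP; split; first by apply: smallest_sub => // _ ->.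
by move=> x Px Q [parQ gQ]; apply: minP => //; apply: gQ.
Qed.

Section ExtensionGraph.
Variable G : sgraph.

Definition ext_vertices : set (raag G) :=
  [set x | exists g v, x = g * raag_gen v * g^-1].

Definition ext_adj : rel (set_type ext_vertices) :=
  fun x y => (x != y) && (val x * val y == val y * val x).

Fact ext_adj_sym : symmetric ext_adj.
Proof. by move=> x y; rewrite /ext_adj eq_sym [_ * _ == _]eq_sym. Qed.

Fact ext_adj_irrefl : irreflexive ext_adj.
Proof. by move=> x; rewrite /ext_adj eqxx. Qed.

Definition ext_graph : sgraph := SGraph ext_adj_sym ext_adj_irrefl.

Fact raag_gen_ext (v : G) : raag_gen v \in ext_vertices.
Proof. by rewrite inE; exists 1, v; rewrite mul1g invg1 mulg1. Qed.

Definition ext_incl (v : G) : ext_graph := SigSub (raag_gen_ext v).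

Lemma raag_gen_inj : injective (@raag_gen G).
Proof.
move=> u v uv; apply/eqP; apply: contraT => neq_uv.
pose f w : 'S_2 := if w == u then tperm ord0 ord_max else 1.
have [h hE] : exists h : {multiplicative raag G -> 'S_2},
    forall v, h (raag_gen v) = f v.
  apply: raag_lift => x y _; rewrite /f /commute.
  by do 2![case: ifP => _]; rewrite ?mulg1 ?mul1g.
have := congr1 h uv; rewrite !hE /f eqxx [v == u]eq_sym (negPf neq_uv).
by move/perm.permP/(_ ord0); rewrite tpermL perm1.
Qed.

Lemma raag_gen_commuteP (u v : G) :
  commute (raag_gen u) (raag_gen v) <-> u = v \/ adj u v.
Proof.
split=> [uv|[->//|]]; last exact: raag_gen_commute.
have [->|neq_uv] := eqVneq u v; [by left|right].
apply: contraT => /negPf nadj_uv.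
pose i : 'I_3 := inord 1.
pose f w : 'S_3 :=
  if w == u then tperm ord0 i else if w == v then tperm i ord_max else 1.
have [h hE] : exists h : {multiplicative raag G -> 'S_3},
    forall v, h (raag_gen v) = f v.
  apply: raag_lift => x y xy; rewrite /f /commute.
  case: (eqVneq x u) xy => [->|_]; case: (eqVneq y u) => [->|_] // xy.
  - by case: eqP xy => [->|_ _]; rewrite ?nadj_uv // mulg1 mul1g.
  - by case: eqP xy => [->|_ _]; rewrite 1?adj_sym ?nadj_uv // mulg1 mul1g.
  - by do 2![case: ifP => _]; rewrite ?mulg1 ?mul1g.
have := gmulf_commute h uv; rewrite !hE /f eqxx [v == u]eq_sym (negPf neq_uv).
rewrite eqxx => /perm.permP/(_ ord0).
have i0 : i != ord0 by rewrite -val_eqE /= inordK.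
rewrite !permM !tpermL [tperm i _ _]tpermD // tpermL => /eqP.
by rewrite -val_eqE /= inordK.
Qed.

Lemma ext_incl_embedding : induced_embedding ext_incl.
Proof.
have inj : injective ext_incl by move=> u v /(congr1 val)/raag_gen_inj.
split=> // u v; rewrite -[adj (ext_incl u) _]/(ext_adj _ _) /ext_adj (inj_eq inj) /=.
apply/andP/idP => [[neq_uv /eqP/raag_gen_commuteP[/eqP|//]]|uv].
  by rewrite (negPf neq_uv).
split; first by apply: contraTneq uv => ->; rewrite adj_irrefl.
exact/eqP/raag_gen_commute.
Qed.

End ExtensionGraph.

Section CliqueGraph.
Variable G : sgraph.
Local Open Scope fset_scope.

Definition is_clique (K : {fset G}) : Prop :=
  {in K &, forall x y, x != y -> adj x y}.

Definition nonempty_clique : pred {fset G} :=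
  fun K => (K != fset0) && `[< is_clique K >].

Definition clique := {K : {fset G} | nonempty_clique K}.
HB.instance Definition _ := Choice.on clique.

Definition clique_adj : rel clique := fun K L =>
  (K != L) && `[< exists M : clique, val K `<=` val M /\ val L `<=` val M >].

Fact clique_adj_sym : symmetric clique_adj.
Proof.
move=> K L; rewrite /clique_adj eq_sym; congr (_ && _).
by apply/asboolP/asboolP => -[M []]; exists M.
Qed.

Fact clique_adj_irrefl : irreflexive clique_adj.
Proof. by move=> K; rewrite /clique_adj eqxx. Qed.

Definition clique_graph : sgraph := SGraph clique_adj_sym clique_adj_irrefl.

End CliqueGraph.

Section CliqueInclusion.
Variable G : sgraph.
Local Open Scope fset_scope.

Fact ext_clique_subproof (K : clique_graph G) :
  nonempty_clique [fset ext_incl x | x in val K].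
Proof.
case: K => K /= /andP[/fset0Pn[x Kx] /asboolP cK]; apply/andP; split.
  by apply/fset0Pn; exists (ext_incl x); apply: in_imfset.
apply/asboolP => _ _ /imfsetP[u Ku ->] /imfsetP[v Kv ->] neq_uv.
rewrite (ext_incl_embedding G).2; apply: cK => //.
by apply: contraNneq neq_uv => ->.
Qed.

Definition clique_incl (K : clique_graph G) : clique_graph (ext_graph G) :=
  exist (@nonempty_clique _) _ (ext_clique_subproof K).

Lemma clique_incl_embedding : induced_embedding clique_incl.
Proof.
have [injG adjG] := ext_incl_embedding G.
have inclE (K : clique_graph G) x :
    (ext_incl x \in val (clique_incl K)) = (x \in val K).
  by apply/imfsetP/idP => [[y Ky /injG->]|Kx] //; exists x.
have inj : injective clique_incl.
  by move=> K L KL; apply/val_inj/fsetP=> x; rewrite -!inclE KL.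
split=> // K L; rewrite -[RHS]/(clique_adj _ _) -[LHS]/(clique_adj _ _) /clique_adj.
rewrite (inj_eq inj).
congr (_ && _); apply/asboolP/asboolP => -[M [KM LM]]; last first.
  by exists (clique_incl M); split; apply: subset_imfset; apply/fsubsetP.
have /fset0Pn[x0 Kx0] : val K != fset0 by case/andP: (valP K).
have cKL : nonempty_clique (val K `|` val L).
  apply/andP; split.
    by apply/fset0Pn; exists x0; rewrite in_fsetU Kx0.
  have inM x : x \in val K `|` val L -> ext_incl x \in val M.
    by rewrite in_fsetU -!inclE => /orP[/(fsubsetP KM)|/(fsubsetP LM)].
  apply/asboolP=> x y /inM Mx /inM My neq_xy; rewrite -adjG.
  have /andP[_ /asboolP cM] := valP M.
  by apply: cM => //; rewrite (inj_eq injG).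
by exists (exist (@nonempty_clique G) _ cKL); split; rewrite /= ?fsubsetUl ?fsubsetUr.
Qed.

End CliqueInclusion.

(* Subgraphs Delta <= Gamma^ext_k are given by their vertex set D. *)
Section Families.
Variable G : sgraph.

Definition clique_subgroup (K : clique_graph (ext_graph G)) : set (raag G) :=
  gen_subgroup [set val x | x in [set` val K]].

Variable D : set (clique_graph (ext_graph G)).

Definition supported_family (g : induced D -> raag G) : Prop :=
  forall K, supp (g K) = clique_subgroup (val K).

Definition separated : Prop :=
  forall K L, D K -> D L -> K != L -> [disjoint val K & val L]%fset.

Definition avoids_squares : Prop :=
  ~ exists s : square -> ext_graph G,
      [/\ induced_square s,
          forall i, exists2 K, D K & s i \in val K
        & exists i j, adj i j /\
            exists K, [/\ D K, s i \in val K & s j \in val K]].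

End Families.

(* Main.v *)
From HB Require Import structures.
Require Import Defs.
From mathcomp Require Import all_boot ssralg ssrnum ssrint finmap zify.
From mathcomp Require Import boolp classical_sets cardinality.

Set Implicit Arguments.
Unset Strict Implicit.
Unset Printing Implicit Defensive.

Local Open Scope classical_set_scope.
Local Open Scope group_scope.

(** Two generators are called apart when they are distinct and not adjacent,
    that is, when they do not commute.  The proof is carried by one invariant
    of the elements of a right-angled Artin group: the front exponent of v in g, the exponent j of
    the largest power of v that can be moved to the front of g, so that
    g = v^j g' with no such power left in g'.  It obeys three rules, for h
    multiplied on the left by a power of u: the exponent is added to the front
    of h at u; the front at v does not change if u and v are adjacent; and the
    front at v vanishes as soon as the front at u does not, if u and v are
    apart ([front_expgz_same], [front_expgz_adj], [front_apart]).  Conversely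
    every element is built from 1 by multiplying by non-trivial powers v^j of
    generators at which its front vanishes ([raag_syllable_ind]), so an element
    all of whose fronts vanish is trivial.  These facts are all that is used of
    normal forms.

    A supported family consists of monomials: g_K is the product of the powers
    v^(n v) for v in K, with all n v non-zero by minimality of the support.
    The map K |-> g_K is then factored into steps that separate one vertex a
    from a clique of size at least two.  Such a step is a map A(H) -> A(H')
    that sends one generator K0 to a product a * b of two commuting generators
    and fixes the others, where the vertices adjacent to K0 are those adjacent
    to both a and b.  Both the disjointness of the cliques and the absence of squares are
    inherited by the intermediate graphs, and after the last step there remains
    a map v |-> v^(n v), which clearly preserves fronts up to the factor n v.

    So everything rests on the injectivity of one step ([merge_map_inj]).  Write
    h for the image of w, k for the front of w at K0 and h = a^p b^q h' with p
    and q the fronts of h at a and b.  If p = q = k held for all w, injectivity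
    would be immediate.  It fails: a letter c apart from a but adjacent to b
    covers K0 in w and a in h, but leaves b at the front of h.  The invariant is
    that p = k or q = k, and that if p = k (say) while q differs from k then
    every letter d apart from b has front 0 in h'.  The second clause
    guarantees that no such d reappears at the front when the surplus power of b
    is later cancelled.  It holds when c arrives because d is apart from c,
    and thus covered by c, or apart from a, and thus covered by the power of a
    under c: otherwise a, b, c, d would be an induced square whose edge a b
    comes from one clique.  *)

(** * Integer powers and morphisms of groups *)
Section IntPower.
Variable H : groupType.
Implicit Types (x y : H) (i j : int).

Definition expgz x j : H :=
  match j with Posz n => x ^+ n | Negz n => x ^- n.+1 end.

Lemma expgz1 x : expgz x 1 = x. Proof. by []. Qed.

Lemma expgzS x j : expgz x (1 + j)%R = x * expgz x j.
Proof.
case: j => [n|[|n]].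
- by rewrite -[RHS]expgS.
- by rewrite [RHS]mulgV.
have -> : (1 + Negz n.+1)%R = Negz n by lia.
by rewrite /= [in RHS]expgSr invgM mulVKg.
Qed.

Lemma expgzD x i j : expgz x (i + j)%R = expgz x i * expgz x j.
Proof.
elim/int_ind: i => [|n IHn|n IHn].
- by rewrite GRing.add0r mul1g.
- have -> : (Posz n.+1 + j)%R = (1 + (n%:Z + j))%R by lia.
  by rewrite expgzS IHn mulgA -expgzS.
- apply: (@mulgI _ x); rewrite -expgzS mulgA -expgzS.
  have -> : (1 + (- n.+1%:Z + j))%R = (- n%:Z + j)%R by lia.
  have -> : (1 - n.+1%:Z)%R = (- n%:Z)%R by lia.
  exact: IHn.
Qed.

Lemma expgzN x j : expgz x (- j)%R = (expgz x j)^-1.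
Proof. by apply/esym/mulg1_eq; rewrite -expgzD GRing.subrr. Qed.

Lemma expgzN1 x : expgz x (-1)%R = x^-1. Proof. by []. Qed.

Lemma commute_expgz x y j : commute x y -> commute x (expgz y j).
Proof. by case: j => n xy; [|apply: commuteV]; apply: commuteX. Qed.

Lemma expgzM x y j :
  commute x y -> expgz (x * y) j = expgz x j * expgz y j.
Proof.
have Mn (n : nat) : commute x y -> expgz (x * y) n = expgz x n * expgz y n.
  by move=> xy; rewrite /= expgMn.
move=> xy; case: j => n; first exact: Mn.
rewrite NegzE !expgzN Mn // -invgM; congr _^-1.
by apply: commute_expgz; apply/commute_sym/commute_expgz/commute_sym.
Qed.

Lemma expgz_mul x i j : expgz x (i * j)%R = expgz (expgz x i) j.
Proof.
elim/int_ind: j => [|n IHn|n IHn].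
- by rewrite GRing.mulr0.
- have -> : (i * n.+1%:Z)%R = (i + i * n%:Z)%R by lia.
  by rewrite -[Posz n.+1]/(1 + n%:Z)%R expgzD expgzS IHn.
- apply: (@mulgI _ (expgz x i)); rewrite -expgzD -expgzS.
  have -> : (i + i * - n.+1%:Z)%R = (i * - n%:Z)%R by lia.
  by have -> : (1 - n.+1%:Z)%R = (- n%:Z)%R by lia.
Qed.

End IntPower.

Section GroupMorphism.
Variables (H K : groupType) (f : {multiplicative H -> K}).

Fact multiplicative1 : f 1 = 1.
Proof. by apply: (@mulgI _ (f 1)); rewrite -gmulfM !mulg1. Qed.

(** The theory of unital morphisms only applies to a multiplicative map of
    groups once the preservation of 1 is recorded in its structure. *)
Definition unital_morphism : UMagmaMorphism.type H K :=
  HB.pack (f : H -> K)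
    (Multiplicative_isUMagmaMorphism.Build H K f multiplicative1)
    (isMultiplicative.Build H K f (@gmulfM _ _ f)).

Lemma multiplicative_expgz x j : f (expgz x j) = expgz (f x) j.
Proof.
case: j => n; first exact: (gmulfXn unital_morphism).
exact: (gmulfXVn unital_morphism).
Qed.

Lemma multiplicative_inj : (forall x, f x = 1 -> x = 1) -> injective f.
Proof. exact: (@gmulf_inj _ _ unital_morphism). Qed.

End GroupMorphism.

(** * Front exponents *)
Section Piling.
Variable G : sgraph.
Implicit Types (u v x : G) (b c : bool) (w : word G).

Definition apart u v := (u != v) && ~~ adj u v.

Lemma apart_sym u v : apart u v = apart v u.
Proof. by rewrite /apart eq_sym adj_sym. Qed.

(** A piling is a family of stacks, one for each vertex.  A reduced word is
    stored by pushing its letters from right to left: the letter (v, b) puts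
    [Some b] on the stack of v and a spacer [None] on the stack of each vertex
    apart from v.  Words that differ by commutations give the same piling. *)
Definition piling := G -> seq (option bool).
Implicit Types s t : piling.

Definition empty_piling : piling := fun=> [::].

Definition push v b s : piling := fun u =>
  if u == v then Some b :: s u else if adj u v then s u else None :: s u.

Definition pop v s : piling := fun u =>
  if (u != v) && adj u v then s u else behead (s u).

Definition pushable v b s := ohead (s v) != Some (Some (~~ b)).

Definition step (l : G * bool) s :=
  if pushable l.1 l.2 s then push l.1 l.2 s else pop l.1 s.

(** On an arbitrary piling [push] and [pop] need not be inverse to each other;
    the action is restricted to the pilings that store reduced words. *)
Inductive reachable : piling -> Prop :=
| reachable0 : reachable empty_piling
| reachableS v b s : reachable s -> pushable v b s -> reachable (push v b s).

Lemma pop_push v b s : pop v (push v b s) = s.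
Proof. by apply/funext => u; rewrite /pop /push; case: eqP; case: (adj u v). Qed.

Lemma push_same v b s : push v b s v = Some b :: s v.
Proof. by rewrite /push eqxx. Qed.

Lemma push_adj u v b s : adj u v -> push v b s u = s u.
Proof.
by move=> uv; rewrite /push uv; case: eqP uv => // ->; rewrite adj_irrefl.
Qed.

Lemma pop_adj u v s : adj u v -> pop v s u = s u.
Proof.
by move=> uv; rewrite /pop uv; case: eqP uv => // ->; rewrite adj_irrefl.
Qed.

Lemma step_adj u v b s : adj u v -> step (v, b) s u = s u.
Proof.
by move=> uv; rewrite /step; case: ifP => _; rewrite ?push_adj ?pop_adj.
Qed.

Lemma push_apart u v b s : apart u v -> push v b s u = None :: s u.
Proof. by rewrite /push => /andP[/negPf-> /negPf->]. Qed.

Lemma push_comm u v b c s :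
  adj u v -> push u b (push v c s) = push v c (push u b s).
Proof.
move=> uv; have vu : adj v u by rewrite adj_sym.
apply/funext => x; have [->|neq_xu] := eqVneq x u.
  by rewrite push_same (push_adj _ _ uv) (push_adj _ _ uv) push_same.
have [->|neq_xv] := eqVneq x v.
  by rewrite push_same (push_adj _ _ vu) (push_adj _ _ vu) push_same.
by rewrite /push (negPf neq_xu) (negPf neq_xv); case: (adj x u); case: (adj x v).
Qed.

(** A letter visible on top of its stack can be taken to have been pushed
    last, since every later letter commutes with it. *)
Lemma reachable_top v b s : reachable s -> ohead (s v) = Some (Some b) ->
  exists t, [/\ reachable t, pushable v b t & s = push v b t].
Proof.
elim=> // u c t rt IHt but.
case: (eqVneq v u) => [->|neq_vu].
  by rewrite push_same => -[<-]; exists t.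
case: (boolP (adj v u)) => [vu|nvu]; last by rewrite push_apart // /apart neq_vu.
rewrite push_adj // => /IHt[t' [rt' bvt' tE]].
exists (push u c t'); split; last by rewrite tE push_comm // adj_sym.
  apply: reachableS => //; move: but.
  by rewrite /pushable tE push_adj // adj_sym.
by rewrite /pushable push_adj.
Qed.

Lemma step_pushable v b s : pushable v b s -> step (v, b) s = push v b s.
Proof. by rewrite /step /= => ->. Qed.

Lemma step_push v b s : step (v, b) (push v (~~ b) s) = s.
Proof. by rewrite /step /pushable /= push_same /= eqxx pop_push. Qed.

Lemma step_poppable v b s : reachable s -> ~~ pushable v b s ->
  exists t, [/\ reachable t, pushable v (~~ b) t, s = push v (~~ b) t
    & step (v, b) s = t].
Proof.
move=> rs /negPn/eqP/(reachable_top rs)[t [rt bt ->]]; exists t; split=> //.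
by rewrite step_push.
Qed.

Lemma reachable_step l s : reachable s -> reachable (step l s).
Proof.
case: l => v b rs; case: (boolP (pushable v b s)) => [bs|].
  by rewrite step_pushable //; apply: reachableS.
by case/(step_poppable rs) => t [rt _ _ ->].
Qed.

Lemma step_cancel v b s : reachable s -> step (v, b) (step (v, ~~ b) s) = s.
Proof.
move=> rs; case: (boolP (pushable v (~~ b) s)) => [bs|].
  by rewrite (step_pushable bs) step_push.
case/(step_poppable rs) => t []; rewrite negbK => _ bt sE ->.
by rewrite step_pushable.
Qed.

Lemma step_push_comm u v b c s : reachable s -> adj u v ->
  step (u, b) (push v c s) = push v c (step (u, b) s).
Proof.
move=> rs uv; case: (boolP (pushable u b s)) => [bs|].
  have bs' : pushable u b (push v c s) by rewrite /pushable push_adj.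
  by rewrite (step_pushable bs) (step_pushable bs') push_comm.
case/(step_poppable rs) => t [_ _ -> ->].
by rewrite (push_comm _ _ _ (etrans (adj_sym v u) uv)) step_push.
Qed.

Lemma step_comm u v b c s : reachable s -> adj u v ->
  step (u, b) (step (v, c) s) = step (v, c) (step (u, b) s).
Proof.
move=> rs uv; case: (boolP (pushable v c s)) => [bs|].
  have bs' : pushable v c (step (u, b) s) by rewrite /pushable step_adj // adj_sym.
  by rewrite (step_pushable bs) (step_pushable bs') step_push_comm.
case/(step_poppable rs) => t [rt _ -> ->].
by rewrite step_push_comm // step_push.
Qed.

(** Letters act from right to left, as in left multiplication. *)
Definition act w s := foldr step s w.

Lemma reachable_act w s : reachable s -> reachable (act w s).
Proof. by move=> rs; elim: w => //= l w; apply: reachable_step. Qed.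

Lemma act_cong w1 w2 s : raag_cong w1 w2 -> reachable s -> act w1 s = act w2 s.
Proof.
move=> w12; elim: w12 s => {w1 w2} //.
- by move=> w1 w2 _ IH s /IH.
- by move=> w2 w1 w3 _ IH1 _ IH2 s rs; rewrite IH1 ?IH2.
- move=> w1 w2 w1' w2' _ IH1 _ IH2 s rs.
  by rewrite /act !foldr_cat -!/(act _ _) IH2 // IH1 //; apply: reachable_act.
- by move=> v b s rs; apply: step_cancel.
- by move=> u v uv s rs; apply: step_comm.
Qed.

Definition pile (g : raag G) : piling := act (repr g) empty_piling.

Lemma pileE w : pile (raag_class w) = act w empty_piling.
Proof. exact/act_cong/reachable0/raag_repr. Qed.

Lemma reachable_pile g : reachable (pile g).
Proof. exact/reachable_act/reachable0. Qed.

Definition sgnb b : int := if b then 1%R else (-1)%R.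

(** A run of letters on top of a stack of a reachable piling has constant sign,
    so this sum is the exponent of the power of v it stores; spacers end it. *)
Fixpoint lead (r : seq (option bool)) : int :=
  if r is Some b :: r' then (sgnb b + lead r')%R else 0%R.

Definition front v g := lead (pile g v).

Lemma raag_class_cons v b w :
  raag_class ((v, b) :: w) = expgz (raag_gen v) (sgnb b) * raag_class w.
Proof.
suff -> : expgz (raag_gen v) (sgnb b) = raag_class [:: (v, b)].
  by rewrite -cat1s -raag_mulE.
case: b => //; rewrite expgzN1; apply: mulg1_eq.
by rewrite [LHS]raag_mulE; apply: raag_class_eq; apply: (raag_cong_cancel v true).
Qed.

Lemma pile_gen v (g : raag G) : pile (raag_gen v * g) = step (v, true) (pile g).
Proof.
elim/raag_ind: g => w; rewrite -[raag_gen v]expgz1 -[1%R]/(sgnb true).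
by rewrite -raag_class_cons !pileE.
Qed.

Lemma front1 v : front v 1 = 0%R.
Proof. by rewrite /front [pile 1]pileE. Qed.

Lemma front_gen_same v g : front v (raag_gen v * g) = (1 + front v g)%R.
Proof.
rewrite /front pile_gen /step; case: ifP => [_|]; first by rewrite push_same.
rewrite /pushable /pop eqxx /=.
by case: (pile g v) => [|[[]|] r] //= _; lia.
Qed.

Lemma front_gen_adj u v g : adj u v -> front v (raag_gen u * g) = front v g.
Proof. by move=> uv; rewrite /front pile_gen step_adj // adj_sym. Qed.

Lemma front_expgz_same v j g :
  front v (expgz (raag_gen v) j * g) = (j + front v g)%R.
Proof.
elim/int_ind: j => [|n IHn|n IHn]; first by rewrite mul1g GRing.add0r.
  by rewrite -[Posz n.+1]/(1 + n%:Z)%R expgzS -mulgA front_gen_same IHn; lia.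
have := front_gen_same v (expgz (raag_gen v) (- n.+1%:Z)%R * g).
rewrite mulgA -expgzS (_ : (1 - n.+1%:Z)%R = (- n%:Z)%R); last by lia.
by rewrite IHn => E; lia.
Qed.

Lemma front_expgz_adj u v j g :
  adj u v -> front v (expgz (raag_gen u) j * g) = front v g.
Proof.
move=> uv; elim/int_ind: j => [|n IHn|n IHn]; first by rewrite mul1g.
  by rewrite -[Posz n.+1]/(1 + n%:Z)%R expgzS -mulgA front_gen_adj.
rewrite -(front_gen_adj (expgz _ _ * _) uv) mulgA -expgzS.
by have -> : (1 - n.+1%:Z)%R = (- n%:Z)%R by lia.
Qed.

(** A non-zero front at u means that a letter u can be taken as the last one
    pushed, and that push left a spacer on top of the stack of v. *)
Lemma front_apart u v g : apart u v -> front u g <> 0%R -> front v g = 0%R.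
Proof.
move=> uv; rewrite /front.
case E: (pile g u) => [|[b|] r] //= _.
have [|t [_ _ ->]] := @reachable_top u b _ (reachable_pile g); first by rewrite E.
by rewrite push_apart // apart_sym.
Qed.

(** Extracting the front power shortens a word by at least the absolute value
    of the exponent, which is what the induction on syllables needs. *)
Lemma reduce_front v w : exists2 w', size w' + `|front v (raag_class w)| <= size w
  & raag_class w = expgz (raag_gen v) (front v (raag_class w)) * raag_class w'.
Proof.
have [n] := ubnP (size w); elim: n v w => // n IHn v [|[y b] w] /= le_wn.
  by exists [::]; rewrite (front1 v) ?mul1g.
have [h0|hn0] := eqVneq (front v (raag_class ((y, b) :: w))) 0%R.
  by exists ((y, b) :: w); rewrite h0 ?mul1g ?addn0.
rewrite raag_class_cons in hn0 *.
have [->|neq_yv] := eqVneq y v.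
  have [w1 le_w1 wE] := IHn v w le_wn.
  exists w1; rewrite front_expgz_same.
    by rewrite /sgnb; case: b {le_wn hn0}; lia.
  by rewrite {1}wE mulgA -expgzD.
have [yv|nyv] := boolP (adj y v).
  have [w1 le_w1 wE] := IHn v w le_wn.
  rewrite front_expgz_adj // in hn0 *.
  exists ((y, b) :: w1); first by rewrite /= addSn ltnS.
  rewrite raag_class_cons {1}wE !mulgA; congr (_ * _).
  apply: commute_expgz; apply/commute_sym/commute_expgz/raag_gen_commute.
  by rewrite adj_sym.
have apyv : apart y v by rewrite /apart neq_yv.
(* As v can be moved past the first letter y, that letter must cancel in w. *)
have hy0 : front y (expgz (raag_gen y) (sgnb b) * raag_class w) = 0%R.
  by apply: contraNeq hn0 => /eqP/(front_apart apyv)->.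
move: hy0; rewrite front_expgz_same => hy0.
have [w1 le_w1 wE] := IHn y w le_wn.
have gE : expgz (raag_gen y) (sgnb b) * raag_class w = raag_class w1.
  by rewrite wE mulgA -expgzD hy0 mul1g.
have h1 : 0 < `|front y (raag_class w)|.
  by move: hy0; rewrite /sgnb; case: b {le_wn hn0 gE} => hy0; lia.
have lt_w1 : size w1 < size w by lia.
rewrite gE; have [w2 le_w2 w1E] := IHn v w1 (ltn_trans lt_w1 le_wn).
by exists w2 => //; lia.
Qed.

(** The first letter of a word is merged with the power of the same generator
    at the front of the rest, or removed if they cancel. *)
Lemma raag_syllable_ind (P : raag G -> Prop) :
    P 1 ->
    (forall v j g, j != 0%R -> front v g = 0%R -> P g ->
       P (expgz (raag_gen v) j * g)) ->
  forall g, P g.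
Proof.
move=> P1 PS; elim/raag_ind=> w.
have [n] := ubnP (size w); elim: n w => // n IHn [//|[y b] w] /= le_wn.
have [hw0|hwn0] := eqVneq (front y (raag_class w)) 0%R.
  by rewrite raag_class_cons; apply: PS => //; [case: b|apply: IHn].
have [w1 le_w1 wE] := reduce_front y w.
have lt_w1 : size w1 < n by lia.
have h1 : front y (raag_class w1) = 0%R.
  by have := congr1 (front y) wE; rewrite front_expgz_same; lia.
rewrite raag_class_cons wE mulgA -expgzD.
have [->|nz] := eqVneq (sgnb b + front y (raag_class w))%R 0%R.
  by rewrite mul1g; apply: IHn.
by apply: PS => //; apply: IHn.
Qed.

Lemma front_eq0 g : (forall v, front v g = 0%R) -> g = 1.
Proof.
elim/raag_syllable_ind: g => // v j g /eqP nz_j h0 _ /(_ v).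
by rewrite front_expgz_same h0 GRing.addr0.
Qed.

Lemma raag_hom_ext (H : groupType) (f1 f2 : {multiplicative raag G -> H}) :
  (forall v, f1 (raag_gen v) = f2 (raag_gen v)) -> f1 =1 f2.
Proof.
move=> f12; elim/raag_syllable_ind => [|v j g _ _ IHg].
  by rewrite !multiplicative1.
by rewrite !gmulfM !multiplicative_expgz f12 IHg.
Qed.

End Piling.

Lemma front_kill (G : sgraph) (u v : G) j (g : raag G) :
  apart u v -> j != 0%R -> front u g = 0%R ->
  front v (expgz (raag_gen u) j * g) = 0%R.
Proof.
move=> uv /eqP nz_j h0; apply: front_apart uv _.
by rewrite front_expgz_same h0 GRing.addr0.
Qed.

Lemma apartP (G : sgraph) (u v : G) : u != v -> apart u v \/ adj u v.
Proof. by move=> uv; rewrite /apart uv; case: (adj u v); [right|left]. Qed.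

Lemma expgz_gen_comm (G : sgraph) (u v : G) i j (g : raag G) : adj u v ->
  expgz (raag_gen u) i * (expgz (raag_gen v) j * g) =
  expgz (raag_gen v) j * (expgz (raag_gen u) i * g).
Proof.
move=> uv; rewrite !mulgA; congr (_ * _).
apply/commute_expgz/commute_sym/commute_expgz/raag_gen_commute.
by rewrite adj_sym.
Qed.

(** The front of the image at r K is n K times the front at K; both change in
    the same way when a syllable is added. *)
Lemma power_map_inj (H G : sgraph) (r : H -> G) (n : H -> int)
    (f : {multiplicative raag H -> raag G}) :
    induced_embedding r -> (forall K, n K != 0%R) ->
    (forall K, f (raag_gen K) = expgz (raag_gen (r K)) (n K)) ->
  injective f.
Proof.
move=> [r_inj r_adj] n0 fE.
have frontE w L : front (r L) (f w) = (n L * front L w)%R.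
  elim/raag_syllable_ind: w L => [|K j w nz_j hw IHw] L.
    by rewrite multiplicative1 !front1 GRing.mulr0.
  rewrite gmulfM multiplicative_expgz fE -expgz_mul.
  have [->|neq_KL] := eqVneq K L.
    by rewrite !front_expgz_same IHw GRing.mulrDr.
  case: (apartP neq_KL) => KL; last by rewrite !front_expgz_adj ?r_adj.
  rewrite !front_kill // ?GRing.mulr0 ?IHw ?hw ?GRing.mulr0 //.
    by rewrite /apart (inj_eq r_inj) r_adj.
  by rewrite GRing.mulf_neq0.
apply: multiplicative_inj => w fw1; apply: front_eq0 => L.
have /eqP := frontE w L; rewrite fw1 front1 eq_sym GRing.mulf_eq0 (negPf (n0 L)).
by move/eqP.
Qed.

(** * Replacing a generator by a product of two commuting generators *)
Section Merge.
Variables (H G : sgraph) (K0 : H) (r : H -> G).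

(** H arises from G by merging the adjacent vertices a and b into K0; r
    identifies the other vertices of H with vertices of G.  As the conditions are symmetric in a and b, each
    argument below is made for one of the two.  The last clause excludes the
    induced square a, b, r L, r M. *)
Record merges (a b : G) : Prop := Merges {
  merges_adj : adj a b;
  merges_neql L : L != K0 -> a != r L;
  merges_neqr L : L != K0 -> b != r L;
  merges_inj L M : L != K0 -> M != K0 -> L != M -> r L != r M;
  merges_adjE L M : L != K0 -> M != K0 -> adj (r L) (r M) = adj L M;
  merges_adj0 L : L != K0 -> adj L K0 = adj (r L) a && adj (r L) b;
  merges_nosquare L M : L != K0 -> M != K0 ->
    apart (r L) a -> adj (r L) b -> apart (r M) b -> adj (r M) a ->
    apart (r L) (r M)
}.

Lemma merges_sym a b : merges a b -> merges b a.
Proof.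
case=> ab ra rb rinj rE r0 sq; split=> //.
- by rewrite adj_sym.
- by move=> L /r0 ->; rewrite andbC.
by move=> L M L0 M0 *; rewrite apart_sym; apply: sq.
Qed.

(** Removing a power of a from the front of a^i h uncovers no letter apart
    from a, as long as the letters apart from a are buried in h. *)
Definition buried a (h : raag G) :=
  forall L, L != K0 -> apart (r L) a -> front (r L) h = 0%R.

(** The invariant relating the front k of w at K0 to its image h.  The
    exponents p and q are the fronts of h at a and b; at least one of them is
    k, and a possible surplus at the other vertex can be cancelled without
    uncovering anything. *)
Definition merged_front a b (k : int) (h : raag G) :=
  exists p q h', [/\ h = expgz (raag_gen a) p * (expgz (raag_gen b) q * h'),
    front a h' = 0%R, front b h' = 0%R &
    [\/ p = k /\ q = k, p = k /\ buried b h' | q = k /\ buried a h']].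

Lemma merged_front_sym a b k h :
  adj a b -> merged_front a b k h -> merged_front b a k h.
Proof.
move=> ab [p [q [h' [-> ha hb H3]]]]; exists q, p, h'; split=> //.
  by rewrite expgz_gen_comm.
by case: H3 => -[]; [constructor 1|constructor 3|constructor 2].
Qed.

Lemma buried_mul a L j h : L != K0 -> j != 0%R -> front (r L) h = 0%R ->
  (forall M, M != K0 -> M != L -> adj (r L) (r M) -> apart (r M) a ->
     front (r M) h = 0%R) ->
  (forall M, M != K0 -> M != L -> r L != r M) ->
  ~~ apart (r L) a ->
  buried a (expgz (raag_gen (r L)) j * h).
Proof.
move=> L0 nz_j hL hM rinj nLa M M0 Ma.
have neq_ML : M != L by apply: contraNneq nLa => <-.
case: (apartP (rinj M M0 neq_ML)) => LM; first by rewrite front_kill.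
by rewrite front_expgz_adj // hM.
Qed.

Lemma adj_not_apart (u v : G) : adj u v -> ~~ apart u v.
Proof. by rewrite /apart => ->; rewrite andbF. Qed.

(** The critical case: r L kills the front at a but not the front at b, which
    becomes a surplus.  A letter r M apart from b is buried by r L if they are
    apart; if not, the absence of squares makes it apart from a, and then it is
    buried by the power of a that r L has just covered. *)
Lemma merged_front_one_sided a b k h L j : merges a b ->
    L != K0 -> j != 0%R -> front (r L) h = 0%R ->
    apart (r L) a -> adj (r L) b -> merged_front a b k h ->
  merged_front a b 0 (expgz (raag_gen (r L)) j * h).
Proof.
move=> mab L0 nz_j hL La Lb [p [q [h' [hE ha hb cases]]]].
have ab := merges_adj mab; have bL : adj b (r L) by rewrite adj_sym.
have hL' : front (r L) (expgz (raag_gen a) p * h') = 0%R.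
  by rewrite -hL hE expgz_gen_comm // [RHS]front_expgz_adj.
exists 0%R, q, (expgz (raag_gen (r L)) j * (expgz (raag_gen a) p * h')); split.
- by rewrite mul1g hE (expgz_gen_comm _ _ _ ab) [LHS]expgz_gen_comm.
- by rewrite front_kill.
- by rewrite !front_expgz_adj // adj_sym.
have [->|nz_q] := eqVneq q 0%R; first by constructor 1.
constructor 2; split=> //; apply: buried_mul => //; last first.
- exact: adj_not_apart.
- by move=> M M0; rewrite eq_sym; apply: merges_inj mab _ _ _ _.
move=> M M0 neq_ML LM Mb.
have aM : apart a (r M).
  case: (apartP (merges_neql mab M0)) => // aM; rewrite adj_sym in aM.
  by have := merges_nosquare mab L0 M0 La Lb Mb aM; rewrite /apart LM andbF.
have [p0|nz_p] := eqVneq p 0%R; last by rewrite front_kill.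
rewrite p0 mul1g; case: cases => -[kE].
- by move=> qk; case/eqP: nz_q; rewrite qk -kE.
- exact.
- by apply=> //; rewrite apart_sym.
Qed.

Lemma merged_front_step a b w h L j : merges a b ->
    L != K0 -> j != 0%R -> front L w = 0%R -> front (r L) h = 0%R ->
    merged_front a b (front K0 w) h ->
  merged_front a b (front K0 (expgz (raag_gen L) j * w))
    (expgz (raag_gen (r L)) j * h).
Proof.
move=> mab L0 nz_j hw hL sh; have ab := merges_adj mab.
have Ea := apartP (merges_neql mab L0); have Eb := apartP (merges_neqr mab L0).
rewrite apart_sym adj_sym in Ea; rewrite apart_sym adj_sym in Eb.
have := merges_adj0 mab L0.
case: Ea Eb => La [] Lb.
- rewrite (negPf (andP La).2) /= => LK0.
  rewrite (@front_kill _ L K0) // /apart ?L0 ?LK0 //.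
  exists 0%R, 0%R, (expgz (raag_gen (r L)) j * h); split.
  + by rewrite !mul1g.
  + by rewrite front_kill.
  + by rewrite front_kill.
  + by constructor 1.
- rewrite (negPf (andP La).2) /= => LK0.
  rewrite (@front_kill _ L K0) // /apart ?L0 ?LK0 //.
  exact: merged_front_one_sided sh.
- rewrite (negPf (andP Lb).2) andbF /= => LK0.
  rewrite (@front_kill _ L K0) // /apart ?L0 ?LK0 //.
  apply: merged_front_sym; first by rewrite adj_sym.
  apply: merged_front_one_sided (merged_front_sym ab sh) => //.
  exact: merges_sym.
rewrite La Lb => /= LK0; rewrite front_expgz_adj //.
case: sh => p [q [h' [hE ha hb cases]]].
have hL' : front (r L) h' = 0%R.
  by rewrite -hL hE !front_expgz_adj // adj_sym.
exists p, q, (expgz (raag_gen (r L)) j * h'); split.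
- by rewrite hE (expgz_gen_comm _ _ _ La) (expgz_gen_comm _ _ _ Lb).
- by rewrite front_expgz_adj.
- by rewrite front_expgz_adj.
have rinj M : M != K0 -> M != L -> r L != r M.
  by move=> M0; rewrite eq_sym; apply: merges_inj mab _ _ _ _.
case: cases => -[kE H2]; [constructor 1|constructor 2|constructor 3] => //.
  split=> //; apply: buried_mul => //; last exact: adj_not_apart.
  by move=> M M0 _ _; apply: H2.
split=> //; apply: buried_mul => //; last exact: adj_not_apart.
by move=> M M0 _ _; apply: H2.
Qed.

(** When K0 reaches the front of w, every letter not adjacent to K0 loses its
    front in the image.  This could only fail for a letter apart from b alone,
    with q = 0 because j has cancelled a surplus of b; such a letter is
    buried. *)
Lemma merged_kill a b j q h L : merges a b -> L != K0 -> ~~ adj L K0 ->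
    j != 0%R -> front a h = 0%R -> front b h = 0%R -> q = j \/ buried b h ->
  front (r L) (expgz (raag_gen a) j * (expgz (raag_gen b) q * h)) = 0%R.
Proof.
move=> mab L0 LK0 nz_j ha hb cov; have ab := merges_adj mab.
case: (apartP (merges_neql mab L0)) => aL.
  by rewrite front_kill // front_expgz_adj // adj_sym.
have bL : apart b (r L).
  case: (apartP (merges_neqr mab L0)) => // bL; move: LK0.
  by rewrite (merges_adj0 mab L0) !(adj_sym (r L)) aL bL.
rewrite front_expgz_adj //.
have [q0|nz_q] := eqVneq q 0%R; last by rewrite front_kill.
case: cov => [qj|burb]; last by rewrite q0 mul1g burb // apart_sym.
by case/eqP: nz_j; rewrite -qj.
Qed.

(** A syllable at K0 shifts both exponents by j and does not touch h', so that
    a surplus of a or b keeps its size and what is buried stays so. *)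
Lemma merged_front_merge a b k h j : adj a b -> k = 0%R -> merged_front a b k h ->
  exists p q h', [/\ (p = j /\ (q = j \/ buried b h')) \/ (q = j /\ buried a h'),
    front a h' = 0%R, front b h' = 0%R &
    [/\ h = expgz (raag_gen a) (p - j)%R * (expgz (raag_gen b) (q - j)%R * h') &
    expgz (raag_gen a * raag_gen b) j * h =
      expgz (raag_gen a) p * (expgz (raag_gen b) q * h')]].
Proof.
move=> ab -> [p [q [h' [-> ha hb cases]]]].
exists (j + p)%R, (j + q)%R, h'; split=> //.
  case: cases => -[-> H2]; rewrite GRing.addr0; [left|left|right]; split=> //.
    by left; rewrite H2 GRing.addr0.
  by right.
have Dj i : (j + i - j = i)%R by lia.
rewrite !Dj; split=> //.
rewrite expgzM; last exact: raag_gen_commute.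
rewrite -mulgA (expgz_gen_comm _ _ _ (etrans (adj_sym b a) ab)) !mulgA.
rewrite -expgzD -mulgA -mulgA -[RHS]mulgA; congr (_ * _).
by rewrite [LHS]mulgA -expgzD.
Qed.

Lemma merge_fronts a b (f : {multiplicative raag H -> raag G}) : merges a b ->
    f (raag_gen K0) = raag_gen a * raag_gen b ->
    (forall L, L != K0 -> f (raag_gen L) = raag_gen (r L)) ->
  forall w, (forall L, L != K0 -> front (r L) (f w) = front L w) /\
            merged_front a b (front K0 w) (f w).
Proof.
move=> mab fK0 fL; have ab := merges_adj mab.
elim/raag_syllable_ind=> [|K j w nz_j hw [IH0 IHs]].
  rewrite multiplicative1 front1; split=> [L _|]; first by rewrite !front1.
  exists 0%R, 0%R, 1; split; rewrite ?front1 ?mul1g //.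
  by constructor 1.
rewrite gmulfM multiplicative_expgz.
have [EK|K_K0] := eqVneq K K0; last first.
  rewrite fL //; split=> [L L0|]; last first.
    by apply: merged_front_step => //; rewrite IH0.
  have [->|neq_KL] := eqVneq K L; first by rewrite !front_expgz_same IH0.
  case: (apartP neq_KL) => KL.
    rewrite !front_kill // ?IH0 // /apart (merges_adjE mab) // (andP KL).2 andbT.
    exact: merges_inj mab _ _ _ _ _.
  by rewrite !front_expgz_adj ?(merges_adjE mab) // IH0.
subst K; rewrite fK0 front_expgz_same hw GRing.addr0.
have [p [q [h' [cases ha hb [hE ->]]]]] := merged_front_merge j ab hw IHs.
split=> [L L0|]; last first.
  exists p, q, h'; split=> //.
  case: cases => -[-> H2]; last by constructor 3.
  by case: H2; [constructor 1|constructor 2].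
have [LK0|LK0] := boolP (adj L K0).
  have := merges_adj0 mab L0; rewrite LK0 => /esym/andP[aL bL].
  rewrite adj_sym in LK0; rewrite adj_sym in aL; rewrite adj_sym in bL.
  by rewrite [RHS]front_expgz_adj // -IH0 // hE !front_expgz_adj.
rewrite [RHS]front_kill //; last by rewrite /apart eq_sym L0 adj_sym.
case: cases => -[-> cov]; first exact: merged_kill cov.
rewrite expgz_gen_comm //; apply: merged_kill => //; last by right.
exact: merges_sym.
Qed.

Lemma merge_map_inj a b (f : {multiplicative raag H -> raag G}) : merges a b ->
    f (raag_gen K0) = raag_gen a * raag_gen b ->
    (forall L, L != K0 -> f (raag_gen L) = raag_gen (r L)) ->
  injective f.
Proof.
move=> mab fK0 fL; apply: multiplicative_inj => w fw1.
have [front_f [p [q [h' [hE ha hb cases]]]]] := merge_fronts mab fK0 fL w.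
have ab := merges_adj mab; apply: front_eq0 => L.
have [->|L0] := eqVneq L K0; last by rewrite -front_f // fw1 front1.
(* The image is 1, so both its fronts vanish and k is one of them. *)
have p0 : p = 0%R.
  have := congr1 (front a) hE; rewrite fw1 front1 front_expgz_same.
  by rewrite front_expgz_adj 1?adj_sym // ha GRing.addr0.
have q0 : q = 0%R.
  have := congr1 (front b) hE; rewrite fw1 front1 front_expgz_adj //.
  by rewrite front_expgz_same hb GRing.addr0.
by case: cases => -[<-].
Qed.

End Merge.

(** * Quotients by disjoint cliques *)
Section CliqueQuotient.
Variable G : sgraph.
Implicit Types (s : seq G) (n : G -> int).

Definition monomial n s : raag G := \prod_(v <- s) expgz (raag_gen v) (n v).

Lemma commute_monomial n s1 s2 :
    {in s1 & s2, forall x y, x != y -> adj x y} ->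
  commute (monomial n s1) (monomial n s2).
Proof.
move=> s12; rewrite /monomial [X in commute X]big_seq [X in commute _ X]big_seq.
apply: commute_prod => y s2y; apply/commute_sym/commute_prod => x s1x.
apply/commute_expgz/commute_sym/commute_expgz/raag_gen_commuteP.
by case: (eqVneq x y) => [->|/(s12 x y s1x s2y)]; [left|right].
Qed.

Lemma monomial_split n s (Q : pred G) :
    {in s &, forall x y, x != y -> adj x y} ->
  monomial n s = monomial n (filter Q s) * monomial n (filter (predC Q) s).
Proof.
elim: s => [|x s IHs] cs /=; first by rewrite /monomial !big_nil mulg1.
have {}IHs :
    monomial n s = monomial n (filter Q s) * monomial n (filter (predC Q) s).
  by apply: IHs => u v us vs; apply: cs; rewrite inE ?us ?vs orbT.
rewrite {1}/monomial big_cons -/(monomial n s) IHs.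
case: (Q x) => /=; first by rewrite [in RHS]/monomial big_cons mulgA.
rewrite [monomial n (x :: _)]/monomial big_cons -/(monomial n _) !mulgA.
congr (_ * _); have := @commute_monomial n [:: x] (filter Q s).
rewrite [monomial n [:: x]]/monomial big_seq1.
apply=> u v; rewrite inE mem_filter => /eqP-> /andP[_ sv]; apply: cs.
  exact: mem_head.
by rewrite inE sv orbT.
Qed.

(** The vertices of H stand for the fibers of p on s, which are disjoint
    non-empty cliques of G; two fibers are adjacent when their union is a
    clique.  The last clause excludes the induced squares x, y, u, v in s
    that have an edge x y in a fiber. *)
Record clique_quotient (H : sgraph) s (p : G -> H) : Prop := CliqueQuotient {
  cq_uniq : uniq s;
  cq_onto K : exists2 v, v \in s & p v = K;
  cq_clique : {in s &, forall x y, p x = p y -> x != y -> adj x y};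
  cq_adj K L : K != L ->
    (adj K L <-> {in s &, forall x y, p x = K -> p y = L -> adj x y});
  cq_nosquare : forall x y u v, x \in s -> y \in s -> u \in s -> v \in s ->
    x != y -> p x = p y -> adj y u -> adj u v -> adj v x ->
    apart x u -> ~~ apart y v
}.

Definition fiber (H : sgraph) s (p : G -> H) K := [seq v <- s | p v == K].

(** The number of vertices whose fiber is not a singleton: the measure that
    decreases when a vertex is separated from its fiber. *)
Definition collisions (H : sgraph) s (p : G -> H) :=
  count (fun v => has (fun u => (u != v) && (p u == p v)) s) s.

Lemma fiber_commute (H : sgraph) s (p : G -> H) n K L :
  clique_quotient s p -> adj K L ->
  commute (monomial n (fiber s p K)) (monomial n (fiber s p L)).
Proof.
move=> q KL; apply: commute_monomial => x y; rewrite !mem_filter.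
move=> /andP[/eqP px sx] /andP[/eqP py sy] _; move: KL.
have [->|neq_KL] := eqVneq K L; first by rewrite adj_irrefl.
by move/(cq_adj q neq_KL); apply.
Qed.

Lemma monomial_hom (H : sgraph) s (p : G -> H) n : clique_quotient s p ->
  exists f : {multiplicative raag H -> raag G},
    forall K, f (raag_gen K) = monomial n (fiber s p K).
Proof.
by move=> q; apply: raag_lift => K L; apply: fiber_commute.
Qed.

Lemma injective_quotient (H : sgraph) s (p : G -> H) n
    (f : {multiplicative raag H -> raag G}) :
    clique_quotient s p -> {in s &, injective p} ->
    {in s, forall v, n v != 0%R} ->
    (forall K, f (raag_gen K) = monomial n (fiber s p K)) ->
  injective f.
Proof.
move=> q pinj n0 fE.
have /choice[r rP] : forall K, exists v, v \in s /\ p v = K.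
  by move=> K; have [v sv <-] := cq_onto q K; exists v.
have rs K := (rP K).1; have rK K := (rP K).2.
have r_inj : injective r by apply: can_inj rK.
apply: (@power_map_inj _ _ r (fun K => n (r K))).
- split=> // K L; have [->|neq_KL] := eqVneq K L; first by rewrite !adj_irrefl.
  apply/idP/idP => [rKL|/(cq_adj q neq_KL)]; last by apply.
  apply/(cq_adj q neq_KL) => x y sx sy px py.
  by rewrite (pinj x (r K)) ?rK // (pinj y (r L)) ?rK.
- by move=> K; apply: n0.
move=> K; rewrite fE /monomial.
suff -> : fiber s p K = [:: r K] by rewrite big_seq1.
rewrite -(filter_pred1_uniq (cq_uniq q) (rs K)); apply: eq_in_filter => v sv /=.
by apply/eqP/eqP => [pv|->//]; apply: pinj; rewrite // rK.
Qed.

(** ** Separating one vertex from its fiber *)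
Section Split.
Variables (H : sgraph) (s : seq G) (p : G -> H).
Hypothesis q : clique_quotient s p.
Variables (a u0 : G).
Hypotheses (sa : a \in s) (su0 : u0 \in s) (neq_ua : u0 != a) (pua : p u0 = p a).
Let K0 := p a.

(** The new vertex [None] has fiber a alone, and [Some (p a)] keeps the rest of
    the fiber of a, which contains u0. *)
Definition split_map (v : G) : option H := if v == a then None else Some (p v).

Definition split_adj : rel (option H) := fun X Y => (X != Y) &&
  `[< {in s &, forall x y, split_map x = X -> split_map y = Y -> adj x y} >].

Fact split_adj_sym : symmetric split_adj.
Proof.
move=> X Y; rewrite /split_adj eq_sym; congr (_ && _).
by apply/asboolP/asboolP => XY x y sx sy xX yY; rewrite adj_sym; apply: XY.
Qed.

Fact split_adj_irrefl : irreflexive split_adj.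
Proof. by move=> X; rewrite /split_adj eqxx. Qed.

Definition split_graph : sgraph := SGraph split_adj_sym split_adj_irrefl.

Lemma split_map_inj x y : split_map x = split_map y -> p x = p y.
Proof. by rewrite /split_map; do 2![case: eqP => [->|_]] => // -[]. Qed.

Lemma split_map_a : split_map a = None. Proof. by rewrite /split_map eqxx. Qed.

Lemma split_map_other v : v != a -> split_map v = Some (p v).
Proof. by rewrite /split_map => /negPf->. Qed.

Lemma split_quotient : @clique_quotient split_graph s split_map.
Proof.
split; first exact: cq_uniq q.
- case=> [K|]; last by exists a; rewrite ?split_map_a.
  have [v sv <-] := cq_onto q K; have [->|neq_va] := eqVneq v a.
    by exists u0; rewrite // split_map_other // pua.
  by exists v; rewrite // split_map_other.
- by move=> x y sx sy /split_map_inj; apply: cq_clique q _ _ sx sy.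
- move=> X Y neq_XY; rewrite -[adj X Y]/(split_adj X Y) /split_adj neq_XY /=.
  by split=> [/asboolP|?]; last apply/asboolP.
move=> x y u v sx sy su sv xy /split_map_inj pxy.
exact: (cq_nosquare q sx sy su sv xy pxy).
Qed.

Lemma split_collisions : @collisions split_graph s split_map < collisions s p.
Proof.
rewrite /collisions -!size_filter.
set t := filter _ s; set t' := filter _ s.
apply: (@leq_ltn_trans (size (rem a t'))); last first.
  have ta : a \in t'.
    rewrite mem_filter sa andbT; apply/hasP; exists u0 => //.
    by rewrite neq_ua pua eqxx.
  by rewrite size_rem // ltn_predL; case: (t') ta.
apply: uniq_leq_size; first by rewrite filter_uniq // (cq_uniq q).
have ut' : uniq t' by rewrite filter_uniq // (cq_uniq q).
move=> v; rewrite mem_rem_uniq // !inE /= !mem_filter => /andP[/hasP[u su]].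
case/andP=> neq_uv /eqP puv sv; rewrite sv andbT; apply/andP; split.
  have [va|//] := eqVneq v a; move: puv.
  by rewrite va split_map_a split_map_other // -va.
by apply/hasP; exists u => //; rewrite neq_uv; apply/eqP/split_map_inj.
Qed.

(** A square on a, b, L and M in the split graph lifts to a square in G: the
    vertex y of the fiber of a and the vertices x and z over L and M are
    witnesses that the pairs involved are not adjacent. *)
Lemma split_merges :
  @merges H split_graph K0 Some (Some K0 : split_graph) (None : split_graph).
Proof.
have adjP X Y : X != Y -> @adj split_graph X Y <->
    {in s &, forall x y, split_map x = X -> split_map y = Y -> adj x y}.
  exact: cq_adj split_quotient _ _.
have adjSP L M : L != K0 -> L != M -> @adj split_graph (Some L) (Some M) <->
   {in s &, forall x y, x != a -> y != a -> p x = L -> p y = M -> adj x y}.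
  move=> L0 LM; rewrite adjP //; split=> LMadj x y sx sy.
    by move=> xa ya px py; apply: LMadj; rewrite // split_map_other ?px ?py.
  have [->|xa] := eqVneq x a; first by rewrite split_map_a.
  have [->|ya] := eqVneq y a; first by rewrite split_map_a.
  by rewrite !split_map_other // => -[px] [py]; apply: LMadj.
have adjNP L : @adj split_graph (Some L) None <->
   {in s, forall x, x != a -> p x = L -> adj x a}.
  rewrite adjP //; split=> Ladj x.
    by move=> sx xa px; apply: Ladj; rewrite ?split_map_a // split_map_other ?px.
  move=> y sx sy.
  have [->|xa] := eqVneq x a; first by rewrite split_map_a.
  have [->|ya] := eqVneq y a; last by rewrite (split_map_other ya).
  by rewrite split_map_other // => -[px] _; apply: Ladj.
have neq_a L x : L != K0 -> p x = L -> x != a.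
  by move=> L0 px; apply: contraNneq L0 => xa; rewrite -px xa.
split.
- by apply/adjNP => x sx xa px; apply: cq_clique q _ _ _ _ _ _.
- by move=> L; rewrite eq_sym.
- by [].
- by move=> L M _ _ LM.
- move=> L M L0 M0; have [->|LM] := eqVneq L M; first by rewrite !adj_irrefl.
  apply/idP/idP => [/(adjSP _ _ L0 LM)|/(cq_adj q LM)] LMadj.
    apply/(cq_adj q LM) => x y sx sy px py.
    by apply: LMadj => //; [apply: neq_a L0 px|apply: neq_a M0 py].
  by apply/(adjSP _ _ L0 LM) => x y sx sy _ _; apply: LMadj.
- move=> L L0; apply/idP/andP => [/(cq_adj q L0) Ladj|[]].
    split; first by apply/(adjSP _ _ L0 L0) => x y sx sy _ _; apply: Ladj.
    by apply/adjNP => x sx _ px; apply: Ladj.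
  move=> /(adjSP _ _ L0 L0) LK /adjNP LN; apply/(cq_adj q L0) => x y sx sy px py.
  have xa := neq_a _ _ L0 px; have [->|ya] := eqVneq y a; first exact: LN.
  exact: LK.
move=> L M L0 M0 /andP[_ /negP LK] /adjNP LN.
move=> /andP[_ /negP MN] /(adjSP _ _ M0 M0) MK.
have [x [y [sx sy px py [ya nxy]]]] : exists x y,
    [/\ x \in s, y \in s, p x = L, p y = K0 & y != a /\ ~~ adj x y].
  apply: contra_notP LK => nex; apply/(adjSP _ _ L0 L0) => x y sx sy xa ya px py.
  by apply: contraT => nxy; case: nex; exists x, y.
have [z [sz pz nza]] : exists z, [/\ z \in s, p z = M & ~~ adj z a].
  apply: contra_notP MN => nex; apply/adjNP => z sz za pz.
  by apply: contraT => nza; case: nex; exists z.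
have xa := neq_a _ _ L0 px; have za := neq_a _ _ M0 pz.
apply/negP => /negPn; rewrite negb_and !negbK => /orP[/eqP[LM]|LM].
  by case/negP: nza; apply: LN; rewrite // pz LM.
have LM' : L != M by apply: contraTneq LM => ->; rewrite adj_irrefl.
move/(adjSP _ _ L0 LM') : LM => LM.
have ay : adj a y by apply: (cq_clique q) => //; rewrite eq_sym.
have yz : adj y z by rewrite adj_sym; apply: MK.
have zx : adj z x by rewrite adj_sym; apply: LM.
have xa' : adj x a by apply: LN.
have neq_ay : a != y by rewrite eq_sym.
have az : apart a z by rewrite /apart eq_sym za adj_sym.
have yx : apart y x.
  rewrite /apart adj_sym nxy andbT; apply: contraNneq L0 => yx.
  by rewrite -px -yx py.
by have := cq_nosquare q sa sy sz sx neq_ay (esym py) yz zx xa' az; rewrite yx.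
Qed.

Lemma split_fiber n : monomial n (fiber s p K0) =
  monomial n (@fiber split_graph s split_map (Some K0)) *
  monomial n (@fiber split_graph s split_map None).
Proof.
rewrite (@monomial_split n _ (predC1 a)).
  congr (monomial n _ * monomial n _);
    rewrite -filter_predI; apply: eq_filter => v /=;
  by rewrite /split_map; case: (eqVneq v a) => [->|//] /=; rewrite ?eqxx.
move=> x y; rewrite !mem_filter => /andP[/eqP px sx] /andP[/eqP py sy].
by apply: cq_clique q _ _ sx sy _; rewrite px.
Qed.

Lemma split_fiber_other n K : K != K0 ->
  monomial n (fiber s p K) = monomial n (@fiber split_graph s split_map (Some K)).
Proof.
move=> K_K0; congr monomial; apply: eq_filter => v; rewrite /split_map.
by case: (eqVneq v a) => [->|_]; [rewrite eq_sym (negPf K_K0)|].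
Qed.

End Split.

(** The map factors through the split graph as a merge followed by the map for
    a quotient with fewer collisions; without collisions it is a power map. *)
Theorem quotient_map_inj (H : sgraph) s (p : G -> H) n
    (f : {multiplicative raag H -> raag G}) :
    clique_quotient s p -> {in s, forall v, n v != 0%R} ->
    (forall K, f (raag_gen K) = monomial n (fiber s p K)) ->
  injective f.
Proof.
move=> q n0; have [c] := ubnP (collisions s p).
elim: c => // c IHc in H p q f *; rewrite ltnS => le_c fE.
have [/hasP[a sa /hasP[u su /andP[neq_ua /eqP pua]]]|] :=
    boolP (has (fun v => has (fun u => (u != v) && (p u == p v)) s) s).
  pose H' := split_graph s p a; pose p' : G -> H' := split_map p a.
  have q' : clique_quotient s p' by apply: split_quotient q _ _ sa su neq_ua pua.
  have m := split_merges q sa su neq_ua pua.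
  have [f' f'E] := monomial_hom n q'.
  have [g gE] : exists g : {multiplicative raag H -> raag H'}, forall K,
      g (raag_gen K) =
        if K == p a then raag_gen (Some K : H') * raag_gen (None : H')
        else raag_gen (Some K : H').
    have comm0 L : L != p a -> adj L (p a) ->
        commute (raag_gen (Some L : H'))
          (raag_gen (Some (p a) : H') * raag_gen (None : H')).
      move=> L0; rewrite (merges_adj0 m L0) => /andP[La Lb].
      by apply: commuteM; apply: raag_gen_commute.
    apply: raag_lift => K L.
    have [->|K0] := eqVneq K (p a); have [->|L0] := eqVneq L (p a) => KL.
    - by [].
    - by apply/commute_sym/comm0; rewrite // adj_sym.
    - exact: comm0.
    - by apply: raag_gen_commute; rewrite (merges_adjE m).
  have fg : f =1 f' \o g.
    apply: raag_hom_ext => K; rewrite fE /= gE.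
    have [->|neq_K] := eqVneq K (p a).
      by rewrite gmulfM !f'E (split_fiber q).
    by rewrite f'E; apply: split_fiber_other.
  apply: (eq_inj _ (fsym fg)); apply: inj_comp.
    apply: (IHc H' p') => //; apply: leq_trans le_c.
    exact: (split_collisions q sa su neq_ua pua).
  apply: (merge_map_inj m); first by rewrite gE eqxx.
  by move=> L /negPf L0; rewrite gE L0.
rewrite -all_predC => /allP nocoll.
apply: injective_quotient q _ n0 fE => x y sx sy pxy.
apply/eqP; apply: contraT => neq_xy; case/negP: (nocoll y sy).
by apply/hasP; exists x; rewrite // neq_xy pxy eqxx.
Qed.

End CliqueQuotient.

(** * Supports and cliques *)
Section Support.
Variable G : sgraph.
Implicit Types (s : seq G) (n : G -> int).

Lemma front_monomial n s v : uniq s -> {in s, forall u, u != v -> adj u v} ->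
  front v (monomial n s) = if v \in s then n v else 0%R.
Proof.
rewrite /monomial; elim: s => [|u s IHs] /=; first by rewrite big_nil front1.
case/andP=> nsu us sv; rewrite big_cons inE.
have {}IHs := IHs us (sub_in1 (@mem_behead _ (u :: s)) sv).
case: (eqVneq v u) IHs => [->|neq_vu] IHs.
  by rewrite front_expgz_same IHs (negPf nsu) GRing.addr0.
by rewrite front_expgz_adj ?IHs // sv ?mem_head // eq_sym.
Qed.

Lemma monomialB n1 n2 s : {in s &, forall x y, x != y -> adj x y} ->
  monomial n1 s / monomial n2 s = monomial (fun v => n1 v - n2 v)%R s.
Proof.
move=> cs; apply/eqP; rewrite divg_eq; apply/eqP; rewrite /monomial !big_seq.
rewrite -prodgM_commute => [|x y sx sy].
  by apply: eq_bigr => v _; rewrite -expgzD GRing.subrK.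
apply/commute_expgz/commute_sym/commute_expgz/raag_gen_commuteP.
by case: (eqVneq y x) => [->|/(cs y x sy sx)]; [left|right].
Qed.

Lemma gen_subgroup_monomial s x :
  uniq s -> {in s &, forall x y, x != y -> adj x y} ->
  gen_subgroup (@raag_gen G @` [set` s]) x ->
  [set monomial n s | n in setT] x.
Proof.
move=> us cs; apply; split.
  split; first by rewrite inE; exists (fun=> 0%R); rewrite // /monomial big1.
  move=> y z; rewrite !inE => -[n1 _ <-] [n2 _ <-].
  by rewrite monomialB //; eexists.
move=> _ [v sv <-] /=; exists (fun u => if u == v then 1%R else 0%R) => //.
rewrite /monomial (eq_bigr (fun u => if u == v then raag_gen v else 1)) => [|u _].
  by rewrite -big_mkcond -big_filter (filter_pred1_uniq us sv) big_seq1.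
by case: eqP => [->|].
Qed.

Lemma monomial_gen_subgroup n s :
  gen_subgroup (@raag_gen G @` [set` s]) (monomial n s).
Proof.
move=> S [cS sS]; have [S1 SD] := cS.
have SM := group_closedM cS; have SV := group_closedV cS.
suff: monomial n s \in S by rewrite inE.
rewrite /monomial big_seq; elim/big_ind: _ => //.
move=> v sv; have Sv : raag_gen v \in S by rewrite inE; apply: sS; exists v.
have SX m : raag_gen v ^+ m \in S by elim: m => // m IHm; rewrite expgS SM.
by case: (n v) => m /=; rewrite ?SV.
Qed.

(** If some n v were 0, the parabolic subgroup generated by the other vertices
    of s would contain the monomial, hence its support, hence v itself; but the
    elements of that subgroup have front 0 at v. *)
Lemma supp_monomial n s : uniq s -> {in s &, forall x y, x != y -> adj x y} ->
    supp (monomial n s) = gen_subgroup (@raag_gen G @` [set` s]) ->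
  {in s, forall v, n v != 0%R}.
Proof.
move=> us cs suppE v sv; apply/eqP => nv0.
pose s' := filter (predC1 v) s.
have s's u : u \in s' -> u \in s by rewrite mem_filter => /andP[].
have gE : monomial n s = monomial n s'.
  rewrite (@monomial_split _ n s (predC1 v) cs) -/s'.
  have -> : filter (predC (predC1 v)) s = [:: v].
    rewrite -(filter_pred1_uniq us sv); apply: eq_filter => u /=.
    exact: negbK.
  by rewrite [monomial n [:: v]]/monomial big_seq1 nv0 mulg1.
pose P := gen_subgroup (@raag_gen G @` [set` s']).
have parP : parabolic P.
  exists [set` s'], 1; apply/seteqP; split => [x Px|_ [x Px <-]].
    by exists x; rewrite // mul1g invg1 mulg1.
  by rewrite mul1g invg1 mulg1.
have Pv : P (raag_gen v).
  have: supp (monomial n s) (raag_gen v).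
    by rewrite suppE; apply: sub_gen_smallest; exists v.
  apply: smallest_sub => // _ ->.
  by rewrite gE; apply: monomial_gen_subgroup.
have us' : uniq s' by rewrite filter_uniq.
have [|n' _ /esym vE] := gen_subgroup_monomial us' _ Pv.
  by move=> x y /s's sx /s's sy; apply: cs.
have := congr1 (front v) vE; rewrite front_monomial.
- rewrite mem_filter /= eqxx /= -[raag_gen v]mulg1 front_gen_same front1 //.
- by [].
by move=> u /s's su; apply: cs.
Qed.

End Support.

Lemma clique_adjP (G : sgraph) (K L : clique_graph G) :
  [disjoint val K & val L]%fset ->
  adj K L <-> {in val K & val L, forall x y, adj x y}.
Proof.
move=> KL0; have /andP[/fset0Pn[x0 Kx0] /asboolP cK] := valP K.
have /andP[_ /asboolP cL] := valP L.
have neqP x y : x \in val K -> y \in val L -> x != y.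
  by move=> Kx Ly; apply: contraTneq Ly => <-; apply: (fdisjointP KL0).
split=> [/andP[_ /asboolP[M [/fsubsetP KM /fsubsetP LM]]] x y Kx Ly|KL].
  have /andP[_ /asboolP cM] := valP M.
  by apply: cM; [exact: KM|exact: LM|exact: neqP].
apply/andP; split.
  by apply/eqP => EKL; have := fdisjointP KL0 x0 Kx0; rewrite -EKL Kx0.
have cKL : nonempty_clique (val K `|` val L)%fset.
  apply/andP; split; first by apply/fset0Pn; exists x0; rewrite in_fsetU Kx0.
  apply/asboolP => x y; rewrite !in_fsetU => /orP[Kx|Lx] /orP[Ky|Ly] xy.
  - exact: cK.
  - exact: KL.
  - by rewrite adj_sym; apply: KL.
  - exact: cL.
apply/asboolP; exists (exist (@nonempty_clique G) _ cKL).
by rewrite /= fsubsetUl fsubsetUr.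
Qed.

Lemma clique_incl_mem (G : sgraph) (K : clique_graph G) x :
  (ext_incl x \in val (clique_incl K)) = (x \in val K).
Proof.
have [injG _] := ext_incl_embedding G.
by apply/imfsetP/idP => [[y Ky /injG->]|Kx] //; exists x.
Qed.

Lemma clique_subgroup_incl (G : sgraph) (K : clique_graph G) (s : seq G) :
  s =i val K ->
  clique_subgroup (clique_incl K) = gen_subgroup (@raag_gen G @` [set` s]).
Proof.
move=> sK; congr gen_subgroup; apply/seteqP; split.
  move=> _ [_ /imfsetP[v Kv ->] <-] /=; exists v => //=.
  by rewrite sK.
move=> _ [v /= sv <-]; exists (ext_incl v) => //=.
by rewrite clique_incl_mem -sK.
Qed.

Lemma four_cycle_square (G : sgraph) (x y u v : G) :
  adj x y -> adj y u -> adj u v -> adj v x -> apart x u -> apart y v ->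
  induced_square (fun i : square => tnth [tuple x; y; u; v] i).
Proof.
move=> xy yu uv vx /andP[neq_xu /negPf nxu] /andP[neq_yv /negPf nyv].
have neqP a b : adj a b -> a != b by apply: contraTneq => ->; rewrite adj_irrefl.
split.
  apply/tuple_uniqP; rewrite /= !inE !negb_or neq_xu neq_yv !neqP //.
  by rewrite adj_sym.
case=> [[|[|[|[|i]]]] // ?] [[|[|[|[|j]]]] // ?];
  rewrite !(tnth_nth x) /= -[RHS]/(square_adj _ _) /square_adj -!val_eqE /=.
all: rewrite ?adj_irrefl // ?xy ?yu ?uv ?vx ?nxu ?nyv //.
all: by rewrite adj_sym ?xy ?yu ?uv ?vx ?nxu ?nyv.
Qed.

(** * Injectivity of the induced homomorphism *)
Theorem lemma6p9 (G : sgraph) (D : set (clique_graph (ext_graph G)))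
    (g : induced D -> raag G) :
  D `<=` range (@clique_incl G) ->
  finite_set D ->
  separated D ->
  avoids_squares D ->
  supported_family g ->
  exists f : {multiplicative raag (induced D) -> raag G},
    (forall K : induced D, f (raag_gen K) = g K) /\ injective f.
Proof.
move=> rangeD finD sepD sqD suppD.
(* An empty D is treated apart: the map p below needs a default value. *)
have [K1|noD] := pselect (inhabited (induced D)); last first.
  have [f fE] : exists f : {multiplicative raag (induced D) -> raag G},
      forall K, f (raag_gen K) = g K.
    by apply: raag_lift => K; case: noD.
  exists f; split=> //; apply: multiplicative_inj => w _.
  by apply: front_eq0 => K; case: noD.
have {K1}[K1] := K1.
have /choice[c cE] : forall K : induced D, exists C, clique_incl C = val K.
  by move=> K; have [C _ <-] := rangeD _ (set_valP K); exists C.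
have memcE K v : (v \in val (c K)) = (ext_incl v \in val (val K)).
  by rewrite -(cE K) clique_incl_mem.
have c_inj K L v : v \in val (c K) -> v \in val (c L) -> K = L.
  rewrite !memcE => Kv Lv; apply/val_inj/eqP.
  apply: contraT => KL.
  have /fdisjointP/(_ _ Kv) := sepD _ _ (set_valP K) (set_valP L) KL.
  by rewrite Lv.
have /choice[p pE] : forall v, exists K, forall L, v \in val (c L) -> L = K.
  move=> v; have [[K Kv]|nK] := pselect (exists K, v \in val (c K)).
    by exists K => L Lv; exact: c_inj _ _ _ Lv Kv.
  by exists K1 => L Lv; case: nK; exists L.
have [l lE] := (finite_seqP D).1 finD.
have lmem (K : induced D) : val K \in l.
  by have /seteqP[Dl _] := lE; exact: (Dl _ (set_valP K)).
pose cells := flatten [seq (val (c K) : seq G) | K <- pmap insub l].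
pose s := undup cells.
have smem v : (v \in s) = (v \in val (c (p v))).
  rewrite mem_undup; apply/flattenP/idP => [[_ /mapP[K _ ->] Kv]|pv].
    by rewrite -(pE _ _ Kv).
  exists (val (c (p v)) : seq G) => //; apply/mapP; exists (p v) => //.
  by rewrite mem_pmap_sub.
have fiberE K v : (v \in fiber s p K) = (v \in val (c K)).
  rewrite mem_filter smem; apply/andP/idP => [[/eqP <-]//|Kv].
  by rewrite -(pE _ _ Kv).
have us : uniq s by apply: undup_uniq.
have cliqueP K : {in val (c K) &, forall x y, x != y -> adj x y}.
  by have /andP[_ /asboolP] := valP (c K).
have q : clique_quotient s p.
  split=> //.
  - move=> K; have /andP[/fset0Pn[v Kv] _] := valP (c K).
    by exists v; rewrite ?smem -(pE _ _ Kv).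
  - move=> x y; rewrite !smem => px py pxy; apply: (cliqueP (p x)) => //.
    by rewrite pxy.
  - move=> K L KL.
    have dis : [disjoint val (c K) & val (c L)]%fset.
      apply/fdisjointP => v Kv; apply: contra KL => Lv.
      exact/eqP/(c_inj _ _ _ Kv Lv).
    have -> : adj K L = adj (c K) (c L).
      by rewrite -(clique_incl_embedding G).2 !cE.
    rewrite (clique_adjP dis); split=> KLadj x y.
      by rewrite !smem => px py pxK pyL; apply: KLadj; rewrite -?pxK -?pyL.
    by move=> Kx Ly; apply: KLadj; rewrite ?smem -?(pE _ _ Kx) -?(pE _ _ Ly).
  move=> x y u v sx sy su sv neq_xy pxy yu uv vx xu; apply/negP => yv.
  have xy : adj x y by apply: (cliqueP (p x)); rewrite // -?smem // pxy -smem.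
  have [emb_inj emb_adj] := four_cycle_square xy yu uv vx xu yv.
  have [ext_inj ext_adj] := ext_incl_embedding G.
  apply: sqD.
  exists (fun i : square => ext_incl (tnth [tuple x; y; u; v] i)); split.
  - split=> [i j /ext_inj/emb_inj//|i j].
    by rewrite ext_adj emb_adj.
  - move=> i; exists (val (p (tnth [tuple x; y; u; v] i))); first exact: set_valP.
    rewrite -memcE -smem.
    by have := mem_tnth i [tuple x; y; u; v]; rewrite !inE => /or4P[] /eqP->.
  exists (@Ordinal 4 0 isT), (@Ordinal 4 1 isT); split=> //.
  exists (val (p x)); split; first exact: set_valP.
    by rewrite -memcE -smem.
  by rewrite -memcE pxy -smem.
have fiber_clique K : {in fiber s p K &, forall x y, x != y -> adj x y}.
  by move=> x y; rewrite !fiberE; apply: cliqueP.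
have subE K : clique_subgroup (val K) =
    gen_subgroup (@raag_gen G @` [set` fiber s p K]).
  by rewrite -cE; apply: clique_subgroup_incl => v; apply: fiberE.
have ufiber K : uniq (fiber s p K) by apply: filter_uniq.
have /choice[m mE] : forall K, exists n, monomial n (fiber s p K) = g K.
  move=> K; have [n _ <-] : [set monomial n (fiber s p K) | n in setT] (g K).
    apply: gen_subgroup_monomial => //; rewrite -subE -suppD.
    exact: sub_gen_smallest.
  by exists n.
pose n v := m (p v) v.
have nE K : monomial n (fiber s p K) = g K.
  rewrite -mE; apply: eq_big_seq => v; rewrite mem_filter /n.
  by case/andP=> /eqP->.
have n0 : {in s, forall v, n v != 0%R}.
  move=> v sv; apply: (@supp_monomial _ n (fiber s p (p v))) => //.
    by rewrite nE suppD subE.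
  by rewrite mem_filter eqxx.
have [f fE] := monomial_hom n q.
exists f; split=> [K|]; first by rewrite fE nE.
exact: quotient_map_inj q n0 fE.
Qed.
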